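(* Let $G$ be a non-complete block graph. Then $\chi_{pcf}(G)\leq\omega(G)+1$. Moreover, $\chi_{pcf}(G)=\omega(G)+1$ if and only if $G$ is a special block graph.
   Context: All graphs are finite, simple, connected and undirected. $N(v)$ is the open neighborhood of $v$, $[k]=\{1,\dots,k\}$, and $\omega(G)$ is the maximum size of a clique of $G$. A proper conflict-free (PCF) $k$-coloring of a graph $G$ is a proper coloring $f:V(G)\to[k]$ such that for every non-isolated vertex $v$ there is a color (depending on $v$) that appears on exactly one vertex of $N(v)$. $\chi_{pcf}(G)$ is the least $k$ such that $G$ admits a PCF $k$-coloring. A vertex $v$ of $G$ is a cut vertex if $G[V\setminus\{v\}]$ is disconnected. A block of $G$ is a maximal connected subgraph that has no cut vertex (of its own). $G$ is a block graph if every block of $G$ is a clique. A block graph $G$ is special if there exists a cut vertex $v$ of $G$ such that at least two blocks containing $v$ are maximum cliques of $G$ (i.e. have $\omega(G)$ vertices). *)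

(* Defs.v *)
From mathcomp Require Import all_boot.

Set Implicit Arguments.
Unset Strict Implicit.
Unset Printing Implicit Defensive.

Record sgraph := SGraph {
  vertex :> finType;
  adj : rel vertex;
  adj_sym : symmetric adj;
  adj_irrefl : irreflexive adj
}.

(* Subgraphs need not be induced; [ssE] is a relation on all of [G] that only
   relates vertices of the subgraph. *)
Record subgraph (G : sgraph) := Subgraph {
  ssV : {set G};
  ssE : rel G;
  ssE_sym : symmetric ssE;
  ssE_sub : forall x y, ssE x y -> [&& x \in ssV, y \in ssV & adj x y]
}.

Section Subgraphs.

Variable G : sgraph.
Implicit Types (H K : subgraph G) (S : {set G}).

Lemma whole_sub (x y : G) :
  adj x y -> [&& x \in [set: G], y \in [set: G] & adj x y].
Proof. by rewrite !inE. Qed.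

Definition whole : subgraph G := Subgraph (@adj_sym G) whole_sub.

Definition induced_rel H S : rel G :=
  [rel x y | [&& x \in S, y \in S & ssE H x y]].

Lemma induced_sym H S : symmetric (induced_rel H S).
Proof. by move=> x y; rewrite /induced_rel /= (@ssE_sym _ H) andbCA. Qed.

Lemma induced_sub H S x y :
  induced_rel H S x y -> [&& x \in ssV H :&: S, y \in ssV H :&: S & adj x y].
Proof.
by case/and3P=> xS yS /ssE_sub /and3P[xH yH xy]; rewrite !inE xS yS xH yH.
Qed.

Definition induced H S : subgraph G :=
  Subgraph (induced_sym H S) (@induced_sub H S).

(* The empty subgraph counts as connected, so the vertex of a one-vertex graph
   is not a cut vertex. *)
Definition connected H : Prop :=
  forall x y, x \in ssV H -> y \in ssV H -> connect (ssE H) x y.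

Definition complete H : Prop :=
  forall x y, x \in ssV H -> y \in ssV H -> x != y -> ssE H x y.

Definition cut_vertex H (v : G) : Prop :=
  v \in ssV H /\ ~ connected (induced H (ssV H :\ v)).

Definition subgraph_le H K : Prop :=
  ssV H \subset ssV K /\ subrel (ssE H) (ssE K).

(* Leibniz equality of the records would also compare the proofs they carry. *)
Definition subgraph_eq H K : Prop := ssV H = ssV K /\ ssE H =2 ssE K.

Definition nonseparable H : Prop :=
  connected H /\ forall v, ~ cut_vertex H v.

Definition block H : Prop :=
  nonseparable H /\
  forall K, nonseparable K -> subgraph_le H K -> subgraph_eq H K.

Definition clique S : bool :=
  [forall x in S, forall y in S, (x != y) ==> adj x y].

End Subgraphs.

Definition omega (G : sgraph) : nat := \max_(S : {set G} | clique S) #|S|.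

Definition maximum_clique (G : sgraph) (S : {set G}) : bool :=
  clique S && (#|S| == omega G).

Definition block_graph (G : sgraph) : Prop :=
  forall B : subgraph G, block B -> complete B.

Definition special_block_graph (G : sgraph) : Prop :=
  block_graph G /\
  exists v : G, cut_vertex (whole G) v /\
  exists B1 B2 : subgraph G,
    [/\ block B1, block B2 & ~ subgraph_eq B1 B2] /\
    [/\ v \in ssV B1, v \in ssV B2,
        maximum_clique (ssV B1) & maximum_clique (ssV B2)].

Definition neighborhood (G : sgraph) (v : G) : {set G} := [set u | adj v u].

Definition pcf_coloring (G : sgraph) (k : nat) (f : {ffun G -> 'I_k}) : bool :=
  [forall x, forall y, adj x y ==> (f x != f y)] &&
  [forall v, (neighborhood v != set0) ==>
     [exists c, #|[set u in neighborhood v | f u == c]| == 1]].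

Definition pcf_colorable (G : sgraph) (k : nat) : bool :=
  [exists f : {ffun G -> 'I_k}, pcf_coloring f].

Lemma pcf_colorable_exists (G : sgraph) : exists k, pcf_colorable G k.
Proof.
exists #|G|; apply/existsP; exists [ffun x => enum_rank x]; apply/andP; split.
  apply/forallP=> x; apply/forallP=> y; apply/implyP=> xy; rewrite !ffunE.
  by apply/eqP=> /enum_rank_inj eq_xy; rewrite eq_xy adj_irrefl in xy.
apply/forallP=> v; apply/implyP=> /set0Pn[u uv].
apply/existsP; exists (enum_rank u); apply/cards1P; exists u.
apply/setP=> w; rewrite in_set in_set1 ffunE (inj_eq enum_rank_inj).
by case: eqP => [->|]; rewrite ?uv ?andbF.
Qed.

Definition chi_pcf (G : sgraph) : nat := ex_minn (pcf_colorable_exists G).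

(* Main.v *)
(** In a block graph, two neighbors of [w] joined by a path avoiding [w] lie with
    [w] on a cycle, hence in a common block, so they are adjacent.

    Coloring with [k] colors, where [k >= omega] and no vertex lies in two cliques
    of size [k]: grow a connected set [S] that contains every block meeting it in
    at least two vertices, coloring at each step all remaining neighbors of some
    [v] in [S].  These split into cliques, one for each new block at [v].  One
    neighbor [u0] of [v], chosen in the block of size [k] at [v] if there is one,
    gets a color [c] that is used nowhere else around [v]; all other blocks at [v]
    have at most [k - 1] vertices, so they can avoid [c].  This applies to
    [k = omega + 1], and to [k = omega] when the graph is not special.

    Conversely, if two blocks of size [omega] meet at [v], then with [omega] colors
    each of them shows every color other than that of [v], so no color appears
    exactly once around [v]. *)
Require Import Defs.
From mathcomp Require Import all_boot.

Set Implicit Arguments.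
Unset Strict Implicit.
Unset Printing Implicit Defensive.

(** * Nonseparable vertex sets, cycles and blocks *)

Section NonseparableSets.

Variable G : sgraph.
Implicit Types (S T A B : {set G}) (u v w x y z : G) (p : seq G).

Local Notation adjin S := (induced_rel (whole G) S).

Definition connected_set S := [forall x in S, forall y in S, connect (adjin S) x y].

Definition nonseparable_set S :=
  connected_set S && [forall z, connected_set (S :\ z)].

Lemma adjinE S x y : adjin S x y = [&& x \in S, y \in S & adj x y].
Proof. by []. Qed.

Lemma connect_adjinC S x y : connect (adjin S) x y = connect (adjin S) y x.
Proof. by apply: sym_connect_sym; exact: induced_sym. Qed.

Lemma connect_adjinS S T x y :
  S \subset T -> connect (adjin S) x y -> connect (adjin T) x y.
Proof.
move=> /subsetP ST; apply: connect_sub => a b /and3P[aS bS ab].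
by apply: connect1; rewrite adjinE !ST.
Qed.

Lemma connected_setP S :
  reflect {in S &, forall x y, connect (adjin S) x y} (connected_set S).
Proof.
apply: (iffP idP) => [/forall_inP h x y xS yS|h].
  by move/forall_inP: (h x xS); apply.
by apply/forall_inP => x xS; apply/forall_inP => y yS; exact: h.
Qed.

Lemma connected_set_root S w :
  (forall x, x \in S -> connect (adjin S) w x) -> connected_set S.
Proof.
move=> h; apply/connected_setP => x y xS yS.
by apply: (@connect_trans _ _ w); first rewrite connect_adjinC; exact: h.
Qed.

Lemma connected_induced S : connected (induced (whole G) S) <-> connected_set S.
Proof.
split=> [h|/connected_setP h x y]; last by rewrite !inE; exact: h.
by apply/connected_setP => x y xS yS; apply: h; rewrite !inE.
Qed.

Lemma connected_ssV (K : subgraph G) : connected K -> connected_set (ssV K).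
Proof.
move=> h; apply/connected_setP => x y xK yK.
have := h x y xK yK; apply: connect_sub => a b /ssE_sub ab.
by apply: connect1.
Qed.

(** Passing to the induced subgraph only adds edges, so connectedness survives, before and after
    deleting a vertex. *)
Lemma nonseparable_ssV (K : subgraph G) :
  nonseparable K -> nonseparable_set (ssV K).
Proof.
move=> [Kc Kn]; rewrite /nonseparable_set connected_ssV //=.
apply/forallP => z; case: (boolP (z \in ssV K)) => zK; last first.
  have -> : ssV K :\ z = ssV K by apply/setDidPl; rewrite disjoint_sym disjoints1.
  exact: connected_ssV.
apply/negPn/negP => nc; apply: (Kn z); split=> // /connected_ssV.
by rewrite /= setIC (setIidPl _) ?subD1set // (negPf nc).
Qed.

Lemma nonseparable_induced S :
  nonseparable_set S -> nonseparable (induced (whole G) S).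
Proof.
move=> /andP[Sc /forallP Sn]; split=> [|z [zS]]; first exact/connected_induced.
have eqS : ssV (induced (induced (whole G) S) (ssV (induced (whole G) S) :\ z))
           = S :\ z.
  by apply/setP => x; rewrite /= !inE /=; case: (x \in S); rewrite ?andbF ?andbT.
apply=> x y; rewrite eqS => xS yS.
have /connected_setP/(_ x y xS yS) := Sn z; apply: connect_sub => a b.
move=> /and3P[/setD1P[az aS] /setD1P[bz bS] ab].
apply: connect1; apply/and3P.
by split; rewrite ?in_setD1 ?az ?bz ?in_setI ?in_setT //; apply/and3P.
Qed.

(** An inclusion-maximal nonseparable set [T] above [S] works: a nonseparable [K] above the subgraph
    induced on [T] has vertex set [T], and that subgraph already has all edges of [G] inside [T]. *)
Lemma block_of_nonseparable S : nonseparable_set S ->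
  exists2 T, block (induced (whole G) T) & S \subset T.
Proof.
move=> Sn; case: (maxset_exists Sn) => T /maxsetP[Tn Tmax] ST.
exists T => //; split; first exact: nonseparable_induced.
move=> K Kn [/= TK eTK].
have KT : ssV K = T.
  by apply: Tmax; [exact: nonseparable_ssV|rewrite -(setTI T)].
split=> [|x y /=]; first by rewrite /= setTI.
apply/idP/idP => [|xy]; first exact: eTK.
by have := ssE_sub xy; rewrite KT.
Qed.

Lemma connect_path S x p y : path (@adj G) x p -> {subset x :: p <= S} ->
  y \in x :: p -> connect (adjin S) x y.
Proof.
move=> xp pS; apply: (@path_connect _ (adjin S)).
apply: (sub_in_path (P := mem S)) xp => [a b aS bS ab|].
  by apply/and3P; split.
by apply/allP.
Qed.

(** Deleting [w] leaves a path; deleting a vertex of the path leaves at most two pieces, each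
    attached to [w] by [u] or by [last u p]. *)
Lemma cycle_nonseparable w u p :
  path (@adj G) u p -> uniq [:: w, u & p] -> adj w u -> adj w (last u p) ->
  nonseparable_set [set x in [:: w, u & p]].
Proof.
move=> up; rewrite cons_uniq => /andP[wp Up] wu wl.
set T := [set x in _]; have inT x : (x \in T) = (x == w) || (x \in u :: p).
  by rewrite in_set inE.
apply/andP; split.
  apply: (@connected_set_root _ w) => x; rewrite inT => /predU1P[->//|xp].
  apply: (@connect_trans _ _ u).
    by apply: connect1; rewrite adjinE !inT eqxx mem_head orbT.
  by apply: connect_path up _ xp => a ap; rewrite inT ap orbT.
apply/forallP => z; case: (eqVneq z w) => [->|zw].
  apply: (@connected_set_root _ u) => x; rewrite in_setD1 inT => /andP[/negPf-> /= xp].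
  apply: connect_path up _ xp => a ap; rewrite in_setD1 inT ap orbT andbT.
  by apply: contraNneq wp => <-.
apply: (@connected_set_root _ w) => x; rewrite in_setD1 inT => /andP[xz].
case/predU1P => [->//|xp].
have step a : a \in u :: p -> a != z -> adj w a -> connect (adjin (T :\ z)) w a.
  move=> ap az wa; apply: connect1.
  by rewrite adjinE !in_setD1 !inT eqxx ap az eq_sym zw orbT.
case: (boolP (z \in u :: p)) => zp; last first.
  apply: (@connect_trans _ _ u).
    by apply: step => //; rewrite ?mem_head //; apply: contraNneq zp => <-; rewrite mem_head.
  apply: connect_path up _ xp => a ap; rewrite in_setD1 inT ap orbT andbT.
  by apply: contraNneq zp => <-.
have Sup : sorted (@adj G) (u :: p) by [].
have lp : last u p \in u :: p by exact: mem_last.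
have [p1 [p2 defp]] : exists p1 p2, u :: p = p1 ++ z :: p2.
  by case/splitPr: zp => p1 p2; exists p1, p2.
move: (Up); rewrite defp cat_uniq /= => /and3P[Up1 /norP[zp1 _] /andP[zp2 _]].
have sub1 a : a \in p1 -> a \in T :\ z.
  move=> ap; rewrite in_setD1 inT defp mem_cat ap orbT andbT.
  by apply: contraNneq zp1 => <-.
have sub2 a : a \in p2 -> a \in T :\ z.
  move=> ap; rewrite in_setD1 inT defp mem_cat inE ap !orbT andbT.
  by apply: contraNneq zp2 => <-.
(* Vertices before [z] are reached from [w] through [u], those after [z] through the last vertex. *)
move: xp; rewrite defp mem_cat inE (negPf xz) /= => /orP[xp|xp].
  case: p1 => [//|u' p1] in defp zp1 Up1 sub1 xp *.
  case: defp => eu ep; subst u'.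
  move: up; rewrite ep cat_path => /andP[up1 _].
  apply: (@connect_trans _ _ u).
    apply: step; rewrite ?mem_head //.
    by apply: contraNneq zp1 => <-; rewrite mem_head.
  exact: connect_path up1 _ xp.
case: p2 => [//|y p2] in defp zp2 sub2 xp *.
have el : last u p = last y p2.
  by have /(congr1 (last u)) := defp; rewrite /= last_cat.
have yp2 : path (@adj G) y p2.
  by move: Sup; rewrite defp => /cat_sorted2[_] /= /andP[].
apply: (@connect_trans _ _ (last u p)).
  apply: step => //; rewrite el.
  by apply: contraNneq zp2 => <-; exact: mem_last.
apply: (@connect_trans _ _ y); last exact: connect_path yp2 _ xp.
by rewrite connect_adjinC; apply: connect_path yp2 _ _ => //; rewrite el mem_last.
Qed.

Lemma cliqueP S :
  reflect {in S &, forall x y, x != y -> adj x y} (clique S).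
Proof.
apply: (iffP forall_inP) => [h x y xS yS xy|h x xS].
  by move/forall_inP: (h x xS) => /(_ y yS); rewrite xy.
by apply/forall_inP => y yS; apply/implyP; exact: h.
Qed.

Lemma clique_omega S : clique S -> #|S| <= omega G.
Proof. by rewrite /omega => Sc; apply: (bigmax_sup S). Qed.

Lemma cliqueS S T : S \subset T -> clique T -> clique S.
Proof.
by move=> /subsetP ST /cliqueP Tc; apply/cliqueP => x y /ST xT /ST yT; exact: Tc.
Qed.

Lemma cliqueU1 v S : clique S -> {in S, forall x, adj v x} -> clique (v |: S).
Proof.
move=> /cliqueP Sc vS; apply/cliqueP => x y.
case/setU1P => [->|xS] /setU1P[->|yS]; rewrite ?eqxx // => xy.
- exact: vS.
- by rewrite adj_sym vS.
- exact: Sc.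
Qed.

Lemma clique_nonseparable S : clique S -> nonseparable_set S.
Proof.
have cc T : clique T -> connected_set T.
  move=> /cliqueP Tc; apply/connected_setP => x y xT yT.
  case: (eqVneq x y) => [->//|xy].
  by apply: connect1; rewrite adjinE xT yT Tc.
move=> Sc; rewrite /nonseparable_set cc //=; apply/forallP => z; apply: cc.
exact: cliqueS (subD1set S z) Sc.
Qed.

End NonseparableSets.

(** * Cliques in block graphs *)

Section BlockGraph.

Variable G : sgraph.
Hypothesis Gblock : block_graph G.
Implicit Types (S T A B : {set G}) (u v w x y z : G).

Local Notation adjin S := (induced_rel (whole G) S).

Lemma nonseparable_clique S : nonseparable_set S -> clique S.
Proof.
move=> /block_of_nonseparable[T /Gblock Tc /subsetP ST].
apply/cliqueP => x y /ST xT /ST yT xy.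
by have /and3P[] : ssE (induced (whole G) T) x y by apply: Tc; rewrite ?inE.
Qed.

Lemma connected_neighbors_adj S w u v :
  connect (adjin S) u v -> w \notin S -> adj w u -> adj w v -> u != v -> adj u v.
Proof.
case/connectP => p0 /shortenP[p up Up _] -> wS wu wv uv.
(* Each edge of [adjin S] has both ends in [S]; [u != v] excludes the empty path, which has no edge
   to put [u] in [S]. *)
have pS : {subset u :: p <= S}.
  case: p up {Up wv} uv => [|y p] /=; first by rewrite eqxx.
  case/andP => /and3P[uS yS _] yp _ x; rewrite inE => /predU1P[->//|].
  elim: p y yS yp => [|z p IH] y yS /=; first by rewrite inE => _ /eqP->.
  case/andP => /and3P[_ zS _] zp; rewrite inE => /predU1P[->//|].
  exact: IH.
have up' : path (@adj G) u p.
  by apply: sub_path up => a b /and3P[].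
have Uw : uniq [:: w, u & p].
  by rewrite cons_uniq Up andbT; apply: contra wS; exact: pS.
have /nonseparable_clique/cliqueP := cycle_nonseparable up' Uw wu wv.
apply; rewrite ?inE ?eqxx ?orbT //.
by have := mem_last u p; rewrite inE => ->; rewrite orbT.
Qed.

Lemma four_cycle_chord w x u v :
  adj w u -> adj w v -> adj x u -> adj x v -> x != w -> u != v -> adj u v.
Proof.
move=> wu wv xu xv xw; apply: (@connected_neighbors_adj [set u; x; v] w) => //.
  apply: (@connect_trans _ _ x); apply: connect1.
    by rewrite adjinE !inE !eqxx !orbT adj_sym.
  by rewrite adjinE !inE !eqxx !orbT.
have ne y : adj w y -> (w == y) = false.
  by move=> wy; apply: contraTF wy => /eqP->; rewrite adj_irrefl.
by rewrite !inE (ne u) // (ne v) // orbF eq_sym (negPf xw).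
Qed.

(** For [a] in [A] only and [b] in [B] only, [v], [a], [x], [b] form a four-cycle, which forces the
    chord [a b]. *)
Lemma cliqueU A B v x : clique A -> clique B -> v != x ->
  v \in A :&: B -> x \in A :&: B -> clique (A :|: B).
Proof.
move=> /cliqueP Ac /cliqueP Bc vx /setIP[vA vB] /setIP[xA xB].
have ne y z S : y \in S -> z \notin S -> y != z.
  by move=> yS; apply: contraNneq => <-.
have cross a b : a \in A -> b \in B -> a != b -> adj a b.
  move=> aA bB ab.
  case: (boolP (b \in A)) => [bA|bA]; first exact: Ac.
  case: (boolP (a \in B)) => [aB|aB]; first exact: Bc.
  apply: (@four_cycle_chord v x) => //; last by rewrite eq_sym.
  - exact: Ac (ne _ _ _ vB aB).
  - exact: Bc (ne _ _ _ vA bA).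
  - exact: Ac (ne _ _ _ xB aB).
  - exact: Bc (ne _ _ _ xA bA).
apply/cliqueP => a b /setUP[aA|aB] /setUP[bA|bB] ab.
- exact: Ac.
- exact: cross.
- by rewrite adj_sym cross // eq_sym.
- exact: Bc.
Qed.

Lemma maximum_clique_block S :
  clique S -> #|S| = omega G -> block (induced (whole G) S).
Proof.
move=> Sc So.
have [T Tb ST] := block_of_nonseparable (clique_nonseparable Sc).
suff -> : S = T by [].
have := nonseparable_ssV Tb.1; rewrite /= setTI => /nonseparable_clique Tc.
by apply/eqP; rewrite eqEcard ST So clique_omega.
Qed.

Lemma special_of_maximum_cliques v A B : clique A -> clique B ->
  #|A| = omega G -> #|B| = omega G -> v \in A -> v \in B -> A != B ->
  special_block_graph G.
Proof.
move=> Ac Bc Ao Bo vA vB AB; split=> //; exists v; split; last first.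
  exists (induced (whole G) A), (induced (whole G) B).
  rewrite /= !setTI vA vB /maximum_clique Ac Bc Ao Bo !eqxx; split=> //; split.
  - exact: maximum_clique_block.
  - exact: maximum_clique_block.
  - by move=> [/= + _]; rewrite !setTI; apply/eqP.
split; first by rewrite inE.
(* If deleting [v] left [G] connected, a vertex [x] of [A] outside [B] would be adjacent to all of
   [B], giving a clique with [omega G + 1] vertices. *)
move=> /connected_induced/connected_setP Gv.
have /subsetPn[x xA xB] : ~~ (A \subset B).
  by apply: contra AB => sAB; rewrite eqEcard sAB Ao Bo leqnn.
have neB y : y \in B -> x != y by move=> yB; apply: contraNneq xB => ->.
have vx : adj v x by move/cliqueP: Ac => -> //; rewrite eq_sym neB.
have xBc : clique (x |: B).
  apply: cliqueU1 => // y yB; case: (eqVneq y v) => [->|yv].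
    by rewrite adj_sym.
  apply: (@connected_neighbors_adj (setT :\ v) v) => //.
  - by apply: Gv; rewrite !inE ?yv ?neB.
  - by rewrite !inE eqxx.
  - by move/cliqueP: Bc => -> //; rewrite eq_sym.
  - exact: neB.
by have := clique_omega xBc; rewrite cardsU1 xB Bo add1n ltnn.
Qed.

End BlockGraph.

(** * Coloring with [k] colors by growing a connected set *)

Section Coloring.

Variables (G : sgraph) (k : nat).
Hypothesis Gblock : block_graph G.
Hypothesis omega_le : omega G <= k.
Hypothesis big_clique_uniq : forall (v : G) (A B : {set G}),
  clique A -> clique B -> v \in A -> v \in B -> k <= #|A| -> k <= #|B| -> A = B.
Implicit Types (S P Q A : {set G}) (r u v w x y z : G) (f g : G -> 'I_k).

Local Notation adjin S := (induced_rel (whole G) S).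

Definition proper_on S f := {in S &, forall x y, adj x y -> f x != f y}.

Definition has_unique_color f v :=
  exists2 u, adj v u & forall x, adj v x -> f x = f u -> x = u.

Lemma exists_fresh_color A f : #|A| < k -> exists c, {in A, forall x, f x != c}.
Proof.
move=> Ak; have /subsetPn[c _ cA] : ~~ ([set: 'I_k] \subset f @: A).
  apply: contraL Ak => /subset_leq_card; rewrite cardsT card_ord -leqNgt => kA.
  exact: leq_trans kA (leq_imset_card f A).
by exists c => x xA; apply: contraNneq cA => <-; exact: imset_f.
Qed.

Lemma adj_neq u v : adj u v -> u != v.
Proof. by move=> uv; apply: contraTneq uv => ->; rewrite adj_irrefl. Qed.

(** For [v] in [S] and a neighbor [w] of [v] outside [S], this is the uncolored part of the block
    containing the edge [v w]. *)
Definition new_class S v w :=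
  [set x in neighborhood v :\: S | (x == w) || adj w x].

Lemma in_new_class S v w x :
  (x \in new_class S v w) = [&& x \notin S, adj v x & (x == w) || adj w x].
Proof. by rewrite !inE andbA. Qed.

Lemma new_class_clique S v w : adj v w -> clique (new_class S v w).
Proof.
move=> vw; apply/cliqueP => x y; rewrite !in_new_class.
case/and3P => _ vx /predU1P[->|wx] /and3P[_ vy /predU1P[->|wy]] xy //.
- by rewrite eqxx in xy.
- by rewrite adj_sym.
- by apply: (four_cycle_chord Gblock vx vy wx wy) => //; rewrite eq_sym adj_neq.
Qed.

(** Classes are cliques, so adjacency is transitive among the new neighbors of [v], and the classes
    partition them. *)
Lemma new_class_eq S v w x : w \notin S -> x \notin S -> adj v w -> adj v x ->
  adj w x -> new_class S v w = new_class S v x.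
Proof.
have sub a b : b \notin S -> adj v a -> adj v b -> adj a b ->
    new_class S v a \subset new_class S v b.
  move=> bS va vb ab; apply/subsetP => y yQ.
  move: (yQ); rewrite !in_new_class => /and3P[-> -> _] /=.
  case: eqVneq => //= yb; move/cliqueP: (new_class_clique S va); apply=> //.
    by rewrite in_new_class bS vb ab orbT.
  by rewrite eq_sym.
move=> wS xS vw vx wx; apply/eqP; rewrite eqEsubset !sub //.
by rewrite adj_sym.
Qed.

Lemma new_class_cliqueU1 S v w : adj v w -> clique (v |: new_class S v w).
Proof.
move=> vw; apply: cliqueU1; first exact: new_class_clique.
by move=> x; rewrite in_new_class => /and3P[].
Qed.

Lemma card_new_classU1 S v w : #|v |: new_class S v w| = #|new_class S v w|.+1.
Proof. by rewrite cardsU1 in_new_class adj_irrefl andbF. Qed.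

(* At most one class can be too large to avoid the colors [c] and [f v]; the
   vertex [u0] carrying [c] is then taken in that class. *)
Lemma exists_witness v S f w0 : v \in S -> proper_on S f ->
  clique (neighborhood v :&: S) -> adj v w0 -> w0 \notin S ->
  exists u0 c, [/\ adj v u0, c != f v, u0 \in S -> f u0 = c,
    forall x, adj v x -> x \in S -> x != u0 -> f x != c &
    forall w, adj v w -> w \notin S -> #|new_class S v w :\ u0|.+2 <= k].
Proof.
move=> vS fS Pc vw0 w0S; set P := neighborhood v :&: S in Pc.
have inP x : adj v x -> x \in S -> x \in P by rewrite !inE => -> ->.
have vPc : clique (v |: P) by apply: cliqueU1 => // x; rewrite !inE => /andP[].
have self w : adj v w -> w \notin S -> w \in new_class S v w.
  by move=> vw wS; rewrite in_new_class wS vw eqxx.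
have fresh u0 : adj v u0 -> u0 \notin S -> #|v |: P| < k ->
  (forall w, adj v w -> w \notin S -> #|new_class S v w :\ u0|.+2 <= k) ->
  exists u0 c, [/\ adj v u0, c != f v, u0 \in S -> f u0 = c,
    forall x, adj v x -> x \in S -> x != u0 -> f x != c &
    forall w, adj v w -> w \notin S -> #|new_class S v w :\ u0|.+2 <= k].
  move=> vu0 u0S /exists_fresh_color-/(_ f)[c cP] Qk; exists u0, c; split=> //.
  - by rewrite eq_sym cP // setU11.
  - by rewrite (negPf u0S).
  - by move=> x vx xS _; rewrite cP // setU1r // inP.
(* If some class reaches size [k] together with [v], uniqueness of big cliques at [v] makes [v |: P]
   and every other class smaller, so [u0] is taken there with a color absent from [v |: P]. *)
case: (pickP [pred w | [&& adj v w, w \notin S & k <= #|v |: new_class S v w|]]).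
  move=> u0 /and3P[vu0 u0S kQ]; apply: (fresh u0) => //.
    rewrite ltnNge; apply/negP => kP.
    have eqPQ := big_clique_uniq vPc (new_class_cliqueU1 S vu0)
      (setU11 _ _) (setU11 _ _) kP kQ.
    have : u0 \in v |: P by rewrite eqPQ setU1r // self.
    by rewrite !inE (negPf u0S) andbF orbF => /eqP eu; rewrite -eu (negPf u0S) in vS.
  move=> w vw wS; case: (boolP (u0 \in new_class S v w)) => [u0w|u0w].
    have := cardsD1 u0 (new_class S v w); rewrite u0w add1n => <-.
    rewrite -card_new_classU1; apply: leq_trans omega_le.
    exact/clique_omega/new_class_cliqueU1.
  apply: leq_trans (_ : #|v |: new_class S v w|.+1 <= k).
    by rewrite card_new_classU1 !ltnS subset_leq_card // subD1set.
  rewrite ltnNge; apply/negP => kw.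
  have eqQ := big_clique_uniq (new_class_cliqueU1 S vu0)
      (new_class_cliqueU1 S vw) (setU11 _ _) (setU11 _ _) kQ kw.
  have : u0 \in v |: new_class S v w by rewrite -eqQ setU1r // self.
  by rewrite in_setU1 (negPf u0w) orbF eq_sym (negPf (adj_neq vu0)).
move=> small.
have Qk w u0 : adj v w -> w \notin S -> #|new_class S v w :\ u0|.+2 <= k.
  move=> vw wS; have := small w; rewrite /= vw wS /= => /negbT.
  rewrite -ltnNge card_new_classU1; apply: leq_trans.
  by rewrite !ltnS subset_leq_card // subD1set.
(* No class is large, so any [u0] meets the size bound: a colored neighbor with its own color if
   there is one, otherwise [w0]. *)
case: (set_0Vmem P) => [P0|[u0 u0P]].
  apply: (fresh w0) => //; last by move=> w; exact: Qk.
  rewrite P0 setU0 cards1; apply: leq_trans (Qk w0 w0 vw0 w0S).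
  by [].
have /setIP[] := u0P; rewrite inE => vu0 u0S.
exists u0, (f u0); split=> // [|x vx xS xu0|w]; last exact: Qk.
  by apply: fS => //; rewrite adj_sym.
by apply: fS => //; move/cliqueP: Pc; apply=> //; exact: inP.
Qed.

(** By the last hypothesis, new vertices touch [S] only at [v]; distinct classes are not adjacent,
    so each can be colored separately, keeping [c] for [u0]. *)
Lemma extend_coloring v S f w0 : v \in S -> proper_on S f ->
  clique (neighborhood v :&: S) -> adj v w0 -> w0 \notin S ->
  (forall x y, x \in S -> y \notin S -> adj v y -> adj x y -> x = v) ->
  exists g, [/\ {in S, g =1 f}, proper_on (S :|: neighborhood v) g &
    has_unique_color g v].
Proof.
move=> vS fS Pc vw0 w0S cut.
have [u0 [c [vu0 cv u0c Pnc Qk]]] := exists_witness vS fS Pc vw0 w0S.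
pose s := enum (~: [set f v; c]).
have ss : size s = k - 2 by rewrite -cardE cardsCs setCK card_ord cards2 eq_sym cv.
(* Within its class, each new vertex takes the color of [s] at its own position. The default [c] of
   [nth] is not reached on neighbors of [v], by [idx]. *)
pose g x := if x \in S then f x else if x == u0 then c
  else nth c s (index x (enum (new_class S v x :\ u0))).
have gS x : x \in S -> g x = f x by rewrite /g => ->.
have idx w : adj v w -> w \notin S -> w != u0 ->
    index w (enum (new_class S v w :\ u0)) < size s.
  move=> vw wS wu0; rewrite ss ltn_subRL add2n.
  apply: leq_trans (Qk w vw wS); rewrite !ltnS cardE index_mem mem_enum.
  by rewrite in_setD1 wu0 in_new_class wS vw eqxx.
have gs w : adj v w -> w \notin S -> w != u0 -> (g w != f v) && (g w != c).
  move=> vw wS wu0; rewrite -negb_or -in_set2 -in_setC -mem_enum.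
  by rewrite /g (negPf wS) (negPf wu0) mem_nth // idx.
have gu0 : g u0 = c by rewrite /g; case: ifP => [/u0c|_] //; rewrite eqxx.
have gv w : adj v w -> w \notin S -> g w != f v.
  move=> vw wS; case: (eqVneq w u0) => [->|wu0]; first by rewrite gu0.
  by case/andP: (gs w vw wS wu0).
have gc w : adj v w -> w != u0 -> g w != c.
  move=> vw wu0; case: (boolP (w \in S)) => wS; first by rewrite gS ?Pnc.
  by case/andP: (gs w vw wS wu0).
exists g; split=> //; last first.
  exists u0 => // x vx; rewrite gu0 => gx; apply/eqP/negPn/negP => xu0.
  by have := gc x vx xu0; rewrite gx eqxx.
have mixed x y : x \in S -> adj v y -> y \notin S -> adj x y -> g x != g y.
  by move=> xS vy yS xy; rewrite (cut x y) // (gS v vS) eq_sym gv.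
move=> x y; rewrite !inE.
case: (boolP (x \in S)) => xS /=; case: (boolP (y \in S)) => yS /=.
- by move=> _ _ xy; rewrite !gS // fS.
- by move=> _ vy xy; exact: mixed.
- by move=> vx _ xy; rewrite eq_sym; apply: mixed; rewrite // adj_sym.
move=> vx vy xy; have [xu0|xu0] := eqVneq x u0.
  by rewrite xu0 gu0 eq_sym gc // -xu0 eq_sym adj_neq.
have [yu0|yu0] := eqVneq y u0; first by rewrite yu0 gu0 gc.
rewrite /g (negPf xS) (negPf yS) (negPf xu0) (negPf yu0).
rewrite nth_uniq ?enum_uniq ?idx //.
have eqQ := new_class_eq xS yS vx vy xy; rewrite eqQ.
have inQ z : z \in new_class S v y -> z != u0 ->
    z \in enum (new_class S v y :\ u0) by rewrite mem_enum in_setD1 => -> ->.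
have xQ : x \in new_class S v y by rewrite in_new_class xS vx adj_sym xy orbT.
have yQ : y \in new_class S v y by rewrite in_new_class yS vy eqxx.
apply: contraNneq (adj_neq xy) => exy.
by rewrite -(nth_index x (inQ x xQ xu0)) exy nth_index ?inQ.
Qed.

(** Since blocks are cliques, [pcf_closed] says that a block with two vertices in [S] lies in [S].
    In [pcf_local], a vertex is either finished or has pairwise adjacent colored neighbors, as when
    only one block at it is colored. *)
Record partial_pcf r S f := PartialPcf {
  pcf_root : {in S, forall x, connect (adjin S) r x};
  pcf_closed : {in S &, forall x y z, adj x y -> adj z x -> adj z y -> z \in S};
  pcf_proper : proper_on S f;
  pcf_local : {in S, forall v,
    neighborhood v \subset S /\ has_unique_color f v \/
    clique (neighborhood v :&: S)}
}.

Lemma extend_partial_pcf r S f v w0 : partial_pcf r S f ->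
  v \in S -> adj v w0 -> w0 \notin S ->
  exists g, partial_pcf r (S :|: neighborhood v) g.
Proof.
move=> [rS clS fS locS] vS vw0 w0S.
have Pc : clique (neighborhood v :&: S).
  by case: (locS v vS) => // -[/subsetP/(_ w0)]; rewrite inE vw0 (negPf w0S) => /(_ isT).
(* Otherwise [x] and [v], joined inside [S] and both adjacent to [y], would be adjacent, and
   [pcf_closed] would put [y] in [S]. *)
have cut x y : x \in S -> y \notin S -> adj v y -> adj x y -> x = v.
  move=> xS yS vy xy; apply/eqP/negPn/negP => xv.
  have vx : adj x v.
    apply: (@connected_neighbors_adj _ Gblock S y); rewrite // 1?adj_sym //.
    apply: (@connect_trans _ _ r); last exact: rS.
    by rewrite connect_adjinC; exact: rS.
  by case/negP: yS; apply: (clS x v) => //; rewrite adj_sym.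
have [g [gS gproper gv]] := extend_coloring vS fS Pc vw0 w0S cut.
have SU x : x \in S -> x \in S :|: neighborhood v by move=> xS; rewrite inE xS.
have locN w : adj v w -> w \notin S ->
    clique (neighborhood w :&: (S :|: neighborhood v)).
  move=> vw wS; apply/cliqueP.
  have nbr x : x \in neighborhood w :&: (S :|: neighborhood v) ->
      adj w x /\ (x = v \/ adj v x).
    rewrite !inE => /andP[wx xSv]; split=> //; case: (boolP (adj v x)) xSv => vx.
      by right.
    by rewrite orbF => xS; left; apply: (cut x w) => //; rewrite adj_sym.
  move=> x y /nbr[wx [->|vx]] /nbr[wy [->|vy]] xy //.
  - by rewrite eqxx in xy.
  - by rewrite adj_sym.
  - by apply: (four_cycle_chord Gblock wx wy vx vy) => //; exact: adj_neq.
exists g; split=> //.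
- move=> x; rewrite !inE; case: (boolP (x \in S)) => xS /= => [_|vx].
    by apply: connect_adjinS (rS x xS); exact: subsetUl.
  apply: (@connect_trans _ _ v).
    by apply: connect_adjinS (rS v vS); exact: subsetUl.
  by apply: connect1; rewrite adjinE !inE vS vx orbT.
- move=> x y xSv ySv z xy zx zy.
  have [xS|xS] := boolP (x \in S); have [yS|yS] := boolP (y \in S).
  + by apply: SU; apply: (clS x y).
  + have vy : adj v y by move: ySv; rewrite !inE (negPf yS).
    by move: zx; rewrite (cut x y) // !inE adj_sym => ->; rewrite orbT.
  + have vx : adj v x by move: xSv; rewrite !inE (negPf xS).
    by move: zy; rewrite (cut y x) // 1?adj_sym // !inE adj_sym => ->; rewrite orbT.
  (* Both [x] and [y] are new: in the four-cycle [v], [x], [z], [y] the chord [z v] puts [z] in the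
     neighborhood of [v]. *)
  have vx : adj v x by move: xSv; rewrite !inE (negPf xS).
  have vy : adj v y by move: ySv; rewrite !inE (negPf yS).
  have [->|zv] := eqVneq z v; first exact: SU.
  suff : adj z v by rewrite !inE adj_sym => ->; rewrite orbT.
  by apply: (@four_cycle_chord _ Gblock x y) => //;
    rewrite 1?eq_sym ?adj_neq // adj_sym.
move=> x; rewrite inE; case: (boolP (x \in S)) => xS /=; last first.
  by rewrite inE => vx; right; exact: locN.
have [->|xv] := eqVneq x v; first by left; split=> //; exact: subsetUr.
(* By [cut], an old vertex other than [v] gains no colored neighbor, so its local condition
   persists. *)
have nbS y : adj x y -> y \in S :|: neighborhood v -> y \in S.
  move=> xy; rewrite !inE; case: (boolP (y \in S)) => yS //= vy.
  by rewrite (cut x y) ?eqxx // in xv.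
case: (locS x xS) => [[xN [u xu xuniq]]|xc].
  left; split; first exact: subset_trans xN (subsetUl _ _).
  have inS y : adj x y -> y \in S by move=> xy; apply: (subsetP xN); rewrite inE.
  by exists u => // y xy; rewrite !gS ?inS //; exact: xuniq.
right; apply: cliqueS xc; apply/subsetP => y /setIP[xy ySv].
by rewrite inE xy nbS // -?in_set //; move: xy; rewrite inE.
Qed.

(** Induction on the number of uncolored vertices, from [[set r]] with a constant coloring. When no
    extension applies, [S] is closed under adjacency, hence everything by connectedness. *)
Lemma exists_partial_pcf r : connected (whole G) ->
  exists f, partial_pcf r [set: G] f.
Proof.
move=> Gconn.
suff ind n S f : #|~: S| <= n -> r \in S -> partial_pcf r S f ->
    exists f, partial_pcf r [set: G] f.
  have r1 : clique [set r].
    by apply/cliqueP => x y /set1P-> /set1P->; rewrite eqxx.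
  have k_gt0 : 0 < k.
    by apply: leq_trans omega_le; rewrite -(cards1 r); exact: clique_omega.
  apply: (ind _ [set r] (fun=> Ordinal k_gt0) (leqnn _)); first exact: set11.
  split.
  - by move=> x /set1P->.
  - by move=> x y /set1P-> /set1P-> z; rewrite adj_irrefl.
  - by move=> x y /set1P-> /set1P->; rewrite adj_irrefl.
  - by move=> x _; right; apply: cliqueS r1; exact: subsetIr.
elim: n S f => [|n IH] S f.
  rewrite leqn0 cards_eq0 => /eqP ST _.
  by rewrite -[S]setCK ST setC0; exists f.
move=> Sn rS Sf.
have [/exists_inP[v vS /existsP[w /andP[vw wS]]]|noext] :=
    boolP [exists v in S, exists w, adj v w && (w \notin S)].
  have [g] := extend_partial_pcf Sf vS vw wS; apply: IH; last by rewrite inE rS.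
  rewrite -ltnS; apply: leq_trans Sn; apply: proper_card; rewrite properC.
  by apply/properP; split; [exact: subsetUl|exists w; rewrite // !inE vw orbT].
have clS : closed (@adj G) (mem S).
  apply: intro_closed => [|x y xy xS]; first exact/sym_connect_sym/adj_sym.
  apply: contraNT noext => yS.
  by apply/exists_inP; exists x => //; apply/existsP; exists y; rewrite xy.
have <- : S = [set: G]; last by exists f.
apply/setP => x; rewrite inE.
by rewrite -(closed_connect clS (Gconn r x _ _)) ?inE.
Qed.

Lemma block_graph_pcf_colorable : connected (whole G) -> 0 < #|G| ->
  pcf_colorable G k.
Proof.
move=> Gconn /card_gt0P[r _].
have [f [_ _ fproper floc]] := exists_partial_pcf r Gconn.
apply/existsP; exists (finfun f); apply/andP; split.
  apply/forallP => x; apply/forallP => y; apply/implyP => xy.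
  by rewrite !ffunE fproper ?inE.
apply/forallP => v; apply/implyP => /set0Pn[w]; rewrite inE => vw.
have [u vu uniq_u] : has_unique_color f v.
  (* If the neighbors of [v] form a clique, properness gives them distinct colors, so any neighbor
     is a witness. *)
  case: (floc v (in_setT v)) => [[]//|/cliqueP vc].
  exists w => // x vx fxw; apply/eqP/negPn/negP => xw.
  have /fproper : adj x w by apply: vc; rewrite ?inE ?vx ?vw.
  by rewrite fxw eqxx !inE => /(_ isT isT).
apply/existsP; exists (f u); apply/cards1P; exists u.
apply/setP => x; rewrite !inE ffunE; apply/andP/eqP => [[vx /eqP]|->].
  exact: uniq_u.
by rewrite eqxx.
Qed.

End Coloring.

(** * The lower bound for special graphs and the equivalence *)

Lemma chi_pcf_le (G : sgraph) k : pcf_colorable G k -> chi_pcf G <= k.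
Proof. by rewrite /chi_pcf; case: ex_minnP => m _; exact. Qed.

(** A color [c] occurring once around [v], at [u], occurs in both maximum blocks, so both contain
    [u] and [v]; then their union is a clique, too large for [omega G]. *)
Lemma special_not_colorable (G : sgraph) k :
  special_block_graph G -> k <= omega G -> ~~ pcf_colorable G k.
Proof.
move=> [Gblock [v [_ [B1 [B2 [[b1 b2 neB] [v1 v2]]]]]]].
move=> /andP[c1 /eqP o1] /andP[c2 /eqP o2] kG.
(* Blocks are complete here, so their vertex sets determine their edges. *)
have neV : ssV B1 <> ssV B2.
  move=> eV; apply: neB; split=> // x y.
  have eE (B B' : subgraph G) : complete B' -> ssV B = ssV B' -> ssE B x y -> ssE B' x y.
    move=> B'c eBV xy; have /and3P[xB yB axy] := ssE_sub xy.
    by apply: B'c; rewrite -?eBV // adj_neq.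
  by apply/idP/idP; apply: eE; rewrite ?eV //; exact: Gblock.
have ncl : ~~ clique (ssV B1 :|: ssV B2).
  apply/negP => /clique_omega cU; apply: neV; apply/eqP.
  have e1 : ssV B1 = ssV B1 :|: ssV B2.
    by apply/eqP; rewrite eqEcard subsetUl o1.
  have e2 : ssV B2 = ssV B1 :|: ssV B2.
    by apply/eqP; rewrite eqEcard subsetUr o2.
  by rewrite e1 -e2.
apply/negP => /existsP[f /andP[/forallP fproper /forallP fpcf]].
have onto B c : clique B -> #|B| = omega G -> exists2 x, x \in B & f x = c.
  move=> /cliqueP Bc Bo.
  have injf : {in B &, injective f}.
    move=> x y xB yB fxy; apply/eqP/negPn/negP => xy.
    by have /forallP/(_ y) := fproper x; rewrite Bc // fxy eqxx.
  have : c \in f @: B.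
    have -> : f @: B = setT; last by [].
    by apply/eqP; rewrite eqEcard subsetT cardsT card_ord card_in_imset // Bo.
  by case/imsetP => x xB ->; exists x.
have adjB B x : clique B -> v \in B -> x \in B -> f x != f v -> adj v x.
  move=> /cliqueP Bc vB xB fxv; apply: Bc => //.
  by apply: contraNneq fxv => ->.
have vN0 : neighborhood v != set0.
  have /subsetPn[x x1 x2] : ~~ (ssV B1 \subset ssV B2).
    by apply/negP => s12; apply: neV; apply/eqP; rewrite eqEcard s12 o1 o2 leqnn.
  apply/set0Pn; exists x; rewrite inE; move/cliqueP: c1; apply=> //.
  by apply: contraNneq x2 => <-.
have /existsP[c /cards1P[u uE]] := implyP (fpcf v) vN0.
have : u \in [set u] by exact: set11.
rewrite -uE !inE => /andP[vu /eqP fu].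
have cv : c != f v by have /forallP/(_ u) := fproper v; rewrite vu -fu eq_sym.
have isu B : clique B -> #|B| = omega G -> v \in B -> u \in B.
  move=> Bc Bo vB; have [x xB fx] := onto B c Bc Bo.
  suff : x \in [set u] by move/set1P <-.
  by rewrite -uE !inE fx eqxx (adjB B) // fx.
case/negP: ncl; apply: (cliqueU Gblock c1 c2 (adj_neq vu)).
  by rewrite inE v1.
by rewrite inE !isu.
Qed.

Theorem theorem6 (G : sgraph) (Gconn : connected (whole G))
    (Gblock : block_graph G) (Gnoncomplete : ~ complete (whole G)) :
  chi_pcf G <= omega G + 1 /\
  (chi_pcf G = omega G + 1 <-> special_block_graph G).
Proof.
have G0 : 0 < #|G|.
  rewrite lt0n; apply: contra_notN Gnoncomplete => /eqP G0 x.
  by have := fintype0 x G0.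
have le1 : chi_pcf G <= omega G + 1.
  apply: chi_pcf_le; apply: block_graph_pcf_colorable => //; first exact: leq_addr.
  (* No clique has [omega G + 1] vertices, so uniqueness of big cliques is vacuous. *)
  by move=> _ A B /clique_omega Ao _ _ _; rewrite addn1 ltnNge Ao.
split=> //; split=> [chiE|Gs]; last first.
  apply/eqP; rewrite eqn_leq le1 /= addn1 ltnNge; apply/negP => le.
  have /negP := special_not_colorable Gs le; apply.
  by rewrite /chi_pcf; case: ex_minnP.
(* This boolean condition on cliques allows a case split; its failure is the uniqueness hypothesis
   for [k = omega G]. *)
case: (boolP [exists v : G, exists A : {set G}, exists B : {set G},
    [&& maximum_clique A, maximum_clique B, v \in A, v \in B & A != B]]).
  move=> /existsP[v /existsP[A /existsP[B]]].
  case/and5P => /andP[Ac /eqP Ao] /andP[Bc /eqP Bo] vA vB AB.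
  exact: special_of_maximum_cliques Ac Bc Ao Bo vA vB AB.
move=> noAB; suff /chi_pcf_le : pcf_colorable G (omega G).
  by rewrite chiE addn1 ltnn.
apply: block_graph_pcf_colorable => // v A B Ac Bc vA vB oA oB.
apply/eqP; apply: contraNT noAB => AB; apply/existsP; exists v.
apply/existsP; exists A; apply/existsP; exists B.
by rewrite /maximum_clique Ac Bc vA vB AB !eqn_leq !clique_omega ?oA ?oB.
Qed.
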